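(* Let $d\ge1$, $0\le n\le N$ be integers and $\rho\in(0,1)^d$ with $|\rho|<1$. For $x\in\mathbb Z_N^{d+1}$ and $\nu\in\mathbb N_0^d$ with $|\nu|=n$, $$\mathsf K_\nu(x;\rho,N)=\frac{(-1)^nn!}{(-N)_n}\sum_{\alpha\in\mathbb Z_n^{d+1}}\frac{\mathsf K_\nu(\alpha;\rho,n)}{\alpha!}\,\mathsf L_\alpha(x;\rho,N),$$ and, conversely, for $x\in\mathbb Z_N^{d+1}$ and $\alpha\in\mathbb Z_n^{d+1}$, $$\mathsf L_\alpha(x;\rho,N)=(-1)^n(-N)_n\,\boldsymbol\rho^\alpha\sum_{\nu\in\mathbb N_0^d,\,|\nu|=n}\frac{\mathsf K_\nu(\alpha;\rho,n)}{\mathsf C_\nu(\rho,n)}\,\mathsf K_\nu(x;\rho,N).$$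
   Context: Notation: $(a)_n=a(a+1)\cdots(a+n-1)$, $(a)_0=1$; for vectors, $|y|$ is the sum of the components, $\alpha!=\prod_i\alpha_i!$, $y^\alpha=\prod_iy_i^{\alpha_i}$, $(y)_\alpha=\prod_i(y_i)_{\alpha_i}$. $\mathbb Z_N^{d+1}=\{\alpha\in\mathbb N_0^{d+1}:|\alpha|=N\}$, $\boldsymbol\rho=(\rho,1-|\rho|)\in\mathbb R^{d+1}$. Inner product: $\langle f,g\rangle_{\mathsf K_{\rho,N}}=N!\sum_{x\in\mathbb Z_N^{d+1}}f(x)g(x)\frac{\boldsymbol\rho^x}{x!}$. $\Pi_n^d$ is the space of polynomials of total degree at most $n$ in $x_1,\dots,x_d$ ($\Pi_{-1}^d=\{0\}$), regarded as functions on $\mathbb Z_N^{d+1}$ (where $x_{d+1}=N-x_1-\cdots-x_d$); polynomials in $x_1,\dots,x_{d+1}$ are regarded as functions on $\mathbb Z_N^{d+1}$ in the same way. For $0\le n\le N$, $\mathcal V_n^d(\mathsf K_{\rho,N})$ is the space of $p\in\Pi_n^d$ orthogonal to $\Pi_{n-1}^d$. Let $\mathrm m_\alpha(x)=(-1)^{|\alpha|}(-x)_\alpha$. For $|\alpha|\le N$ the monic Krawtchouk polynomial $\mathsf L_\alpha(\cdot;\rho,N)$ is the unique element of $\mathcal V_{|\alpha|}^d(\mathsf K_{\rho,N})$ with $\mathsf L_\alpha-\mathrm m_\alpha\in\Pi_{|\alpha|-1}^d$ (as functions on $\mathbb Z_N^{d+1}$). Krawtchouk polynomials: for $\nu\in\mathbb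 N_0^d$ with $|\nu|\le N$ and $x\in\mathbb Z_N^{d+1}$, put $M_j=N-\sum_{i<j}x_i-\sum_{i=j+1}^d\nu_i$ and $$\mathsf K_\nu(x;\rho,N)=\frac{(-1)^{|\nu|}}{(-N)_{|\nu|}}\prod_{j=1}^d\left(\frac{\rho_j}{1-\sum_{i\le j}\rho_i}\right)^{\nu_j}\sum_{k=0}^{\nu_j}\frac{(-\nu_j)_k(-x_j)_k}{k!}\left(\frac{1-\sum_{i<j}\rho_i}{\rho_j}\right)^{k}(-M_j+k)_{\nu_j-k}.$$ The $\mathsf K_\nu(\cdot;\rho,N)$, $|\nu|=n$, form a mutually orthogonal basis of $\mathcal V_n^d(\mathsf K_{\rho,N})$; $\mathsf C_\nu(\rho,N)=\langle\mathsf K_\nu(\cdot;\rho,N),\mathsf K_\nu(\cdot;\rho,N)\rangle_{\mathsf K_{\rho,N}}$. *)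

(* Defs.v *)
From mathcomp Require Import all_boot all_order all_algebra.
From mathcomp Require Import classical_sets.
From mathcomp Require Export mpoly.

Set Implicit Arguments.
Unset Strict Implicit.
Unset Printing Implicit Defensive.

Import Order.TTheory GRing.Theory Num.Theory.

Local Open Scope ring_scope.

(* The finite type Z_N^{d+1} of multi-indices of length d+1 and weight N; the
   bound [mdeg x < N.+1] of 'X_{1..d.+1 < N.+1} only provides finiteness. *)
Definition simplex (d N : nat) : predArgType :=
  {x : 'X_{1..d.+1 < N.+1} | mdeg x == N}.
Definition multinom_of_simplex d N (x : simplex d N) : 'X_{1..d.+1} :=
  val (val x).
Coercion multinom_of_simplex : simplex >-> multinom.

(* Rising factorial (a)_n; the library's falling factorial is nat-valued. *)
Definition poch (R : nzRingType) (a : R) (n : nat) : R :=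
  \prod_(0 <= i < n) (a + i%:R).

Section Krawtchouk.
Context {R : realFieldType} {d : nat}.
Implicit Types (rho : 'I_d -> R) (N b n : nat) (nu : 'X_{1..d})
  (alpha : 'X_{1..d.+1}).

(* [lift ord_max] embeds the indices 1, ..., d into 1, ..., d+1, and [ord_max]
   is the index d+1. *)
Definition rho_bold rho (i : 'I_d.+1) : R :=
  if unlift ord_max i is Some j then rho j else 1 - \sum_j rho j.

Definition mfactorial k (alpha : 'X_{1..k}) : nat := (\prod_i (alpha i)`!)%N.

Definition weight k (y : 'I_k -> R) (alpha : 'X_{1..k}) : R :=
  \prod_i y i ^+ alpha i.

Definition inner rho N (f g : {ffun simplex d N -> R}) : R :=
  N`!%:R * \sum_(x : simplex d N) f x * g x * (weight (rho_bold rho) x / (mfactorial x)%:R).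

(* [msize p] is 1 + the total degree of p, and 0 if p = 0.  Hence
   [is_poly_lt N n.+1] is Pi_n and [is_poly_lt N n] is Pi_{n-1}, including
   Pi_{-1} = {0}, both regarded as spaces of functions on Z_N^{d+1}. *)
Definition is_poly_lt N b (f : {ffun simplex d N -> R}) : Prop :=
  exists2 p : {mpoly R[d]}, (msize p <= b)%N &
    forall x : simplex d N, f x = p.@[fun j => (x (lift ord_max j))%:R].

Definition is_orthopoly rho N n (f : {ffun simplex d N -> R}) : Prop :=
  is_poly_lt n.+1 f /\
  forall g : {ffun simplex d N -> R}, is_poly_lt n g -> inner rho f g = 0.

Definition mono N alpha : {ffun simplex d N -> R} :=
  [ffun x : simplex d N =>
    (-1) ^+ mdeg alpha * \prod_i poch (- (x i)%:R) (alpha i)].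

Definition is_monic_krawtchouk rho N alpha (f : {ffun simplex d N -> R}) :
    Prop :=
  is_orthopoly rho (mdeg alpha) f /\ is_poly_lt (mdeg alpha) (f - mono N alpha).

(* "The unique f such that [is_monic_krawtchouk rho alpha f]"; the default
   value 0 is irrelevant, as such an f exists for 0 < rho, |rho| < 1 and
   |alpha| <= N. *)
Definition monic_krawtchouk rho N alpha : {ffun simplex d N -> R} :=
  xget 0 [set f | is_monic_krawtchouk rho alpha f]%classic.

(* M_j may be negative, so it is computed in R. *)
Definition krawtchouk_M N nu (x : simplex d N) (j : 'I_d) : R :=
  N%:R - \sum_(i < d | (i < j)%N) (x (lift ord_max i))%:R
       - \sum_(i < d | (j < i)%N) (nu i)%:R.

Definition krawtchouk rho N nu : {ffun simplex d N -> R} :=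
  [ffun x : simplex d N =>
    (-1) ^+ mdeg nu / poch (- N%:R) (mdeg nu) *
    \prod_(j < d)
      ((rho j / (1 - \sum_(i < d | (i <= j)%N) rho i)) ^+ nu j *
       \sum_(k < (nu j).+1)
         poch (- (nu j)%:R) k * poch (- (x (lift ord_max j))%:R) k / k`!%:R *
         ((1 - \sum_(i < d | (i < j)%N) rho i) / rho j) ^+ k *
         poch (- krawtchouk_M nu x j + k%:R) (nu j - k))].

Definition krawtchouk_norm rho N nu : R :=
  inner rho (krawtchouk rho N nu) (krawtchouk rho N nu).

End Krawtchouk.

(* Main.v *)
(* With q_j = rho_j / (1 - sum_(i <= j) rho_i), the linear forms
   w_i(t) = 1 - sum_(j < i) q_j t_j + t_i (without t_i when i = d+1) satisfy
     prod_i w_i(t) ^ x_i = sum_nu N^_|nu| / nu! * K_nu(x; rho, N) t^nu,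
   as one sees by expanding the factors from the last one to the first.  The
   coefficient vectors of the forms are orthogonal for the weight rho_bold, so
   the multinomial theorem applied to (sum_i rho_i w_i(s) w_i(t))^N yields the
   orthogonality relations and the norms.  The K_nu are as many as the points
   of the simplex, hence form a basis, and L_alpha is the part of degree n of
   the expansion of m_alpha in this basis.  As sum_i rho_i w_i = 1, summing
   m_alpha against the generating function gives N^_n rho^alpha w(t)^alpha,
   whence <m_alpha, K_nu>_N = n! rho^alpha K_nu(alpha; rho, n) for |nu| = n:
   this is the second formula.  The first one follows from the second by
   orthogonality of the K_nu( . ; rho, n). *)
Require Import Defs.
From mathcomp Require Import all_boot all_order all_algebra.
From mathcomp Require Import ring zify.

Set Implicit Arguments.
Unset Strict Implicit.
Unset Printing Implicit Defensive.

Import Order.TTheory GRing.Theory Num.Theory.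

Local Open Scope ring_scope.

(** * Rising factorials at negated naturals and the expansion in one variable *)

Lemma poch_opp_nat (R : nzRingType) (a k : nat) :
  poch (- a%:R : R) k = (-1) ^+ k * (a ^_ k)%:R.
Proof.
elim: k => [|k IHk]; first by rewrite /poch big_geq // expr0 mul1r.
rewrite /poch big_nat_recr //= -/(poch _ _) IHk ffactnSr natrM exprSr.
have [le_ka|lt_ak] := leqP k a; last by rewrite ffact_small // !(mulr0, mul0r).
by rewrite natrB // -!mulrA mulN1r -mulrN opprB addrC.
Qed.

Section OneVariable.
Variables (R : realFieldType) (q r : R).

(** One factor of the product defining [krawtchouk], with M_j as a free argument; q and r stand for
    the two quotients built from rho. *)
Definition krawtchouk_factor (k x : nat) (M : R) : R :=
  q ^+ k * \sum_(l < k.+1)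
    poch (- k%:R) l * poch (- x%:R) l / l`!%:R * r ^+ l
      * poch (- M + l%:R) (k - l).

Hypothesis qrE : q * r = 1 + q.

(** Falling factorials leave the sign (-1)^(k-l), and q^k r^l = (1+q)^l q^(k-l). The right-hand side
    is the coefficient obtained by expanding (s+t)^x (s-qt)^(M-x) in powers of s-qt first. For l > x
    both sides vanish; for l <= x the hypothesis makes M - l a true difference. *)
Lemma krawtchouk_factor_bin k x M : (x <= M)%N ->
  krawtchouk_factor k x M%:R / k`!%:R =
  \sum_(l < k.+1) 'C(x, l)%:R * (1 + q) ^+ l * (- q) ^+ (k - l)
     * 'C(M - l, k - l)%:R.
Proof.
move=> le_xM; rewrite /krawtchouk_factor mulr_sumr mulr_suml.
apply: eq_bigr => -[l /=]; rewrite ltnS => le_lk _.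
have [le_lx|lt_xl] := leqP l x; last first.
  by rewrite bin_small // !poch_opp_nat (ffact_small lt_xl) !(mulr0, mul0r).
have le_lM := leq_trans le_lx le_xM.
have -> : - M%:R + l%:R = - (M - l)%:R :> R by rewrite natrB // opprB addrC.
rewrite !poch_opp_nat.
rewrite -{1}(subnK le_lk) exprD -!bin_ffact.
have fact_neq0 m : m`!%:R != 0 :> R by rewrite pnatr_eq0 -lt0n fact_gt0.
rewrite -(bin_fact le_lk) !natrM -qrE exprMn [(- q) ^+ _]exprNn.
have sgn2 : (-1) ^+ l * (-1) ^+ l = 1 :> R by rewrite -exprMn mulrNN mulr1 expr1n.
have bin_neq0 : 'C(k, l)%:R != 0 :> R by rewrite pnatr_eq0 -lt0n bin_gt0.
rewrite -[RHS]mul1r -[X in _ = X * _]sgn2.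
move: ((-1) ^+ l) ((-1) ^+ (k - l)) (q ^+ (k - l)) (q ^+ l) (r ^+ l) => *.
field.
by rewrite !fact_neq0 bin_neq0.
Qed.

(** In the binomial form each term has l > x or C(M-l, k-l) = 0. *)
Lemma krawtchouk_factor_eq0 k x M : (x <= M)%N -> (M < k)%N ->
  krawtchouk_factor k x M%:R = 0.
Proof.
move=> le_xM lt_Mk.
have fact_neq0 : k`!%:R != 0 :> R by rewrite pnatr_eq0 -lt0n fact_gt0.
apply: (divIf fact_neq0); rewrite mul0r krawtchouk_factor_bin //.
rewrite big1 // => -[l /= ?] _.
have [le_lx|lt_xl] := leqP l x; last by rewrite bin_small // !mul0r.
by rewrite [X in _ * X%:R]bin_small ?mulr0 //; lia.
Qed.

Variables (A : comNzRingType) (phi : {rmorphism R -> A}).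

(** Write s+t = (s-qt) + (1+q)t, apply the binomial theorem twice and swap the triangular sum over l
    <= k. Terms with k > x+b vanish, so any bound B above x+b will do and the truncated exponent is
    harmless. *)
Lemma expand_two_factors (x b B : nat) (s t : A) : (x + b < B)%N ->
  (s + t) ^+ x * (s - phi q * t) ^+ b =
  \sum_(k < B) phi (krawtchouk_factor k x (x + b)%:R / k`!%:R)
     * t ^+ k * s ^+ (x + b - k).
Proof.
move=> lt_B; set M := (x + b)%N.
pose F l k : A := phi ('C(x, l)%:R * (1 + q) ^+ l * (- q) ^+ (k - l)
     * 'C(M - l, k - l)%:R) * t ^+ k * s ^+ (M - k).
transitivity (\sum_(0 <= l < M.+1) \sum_(l <= k < M.+1) F l k).
  have -> : s + t = (s - phi q * t) + phi (1 + q) * t.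
    by rewrite rmorphD rmorph1; ring.
  rewrite exprDn mulr_suml big_mkord.
  rewrite (big_ord_widen_cond M.+1 xpredT (fun l => (s - phi q * t) ^+ (x - l)
     * (phi (1 + q) * t) ^+ l *+ 'C(x, l) * (s - phi q * t) ^+ b)); last first.
    by rewrite ltnS leq_addr.
  rewrite big_mkcond /=; apply: eq_bigr => -[l /=]; rewrite !ltnS => le_lM _.
  have [le_lx|lt_xl] := leqP l x; last first.
    by rewrite big1 // => k _; rewrite /F bin_small // !mul0r rmorph0 !mul0r.
  rewrite mulrnAl mulrAC -exprD addnBAC // -/M exprDn mulr_suml.
  rewrite -[X in _ = \sum_(X <= _ < _) _]add0n big_addn subSn // big_mkord.
  rewrite -mulr_natl mulr_sumr; apply: eq_bigr => -[m /=]; rewrite ltnS => le_m _.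
  rewrite /F addnK !rmorphM !rmorphXn !rmorph_nat rmorphN.
  rewrite -mulr_natl -mulNr !exprMn exprD -subnDA (addnC l m); ring.
under eq_bigr => l _ do rewrite (big_nat_widenl _ 0) //.
rewrite (exchange_big_dep_nat xpredT) //=.
rewrite big_mkord.
rewrite (big_ord_widen_cond B xpredT (fun k => \sum_(0 <= i < M.+1 | (i <= k)%N) F i k)) //=.
rewrite big_mkcond /=; apply: eq_bigr => -[k /= lt_kB] _.
rewrite ltnS; have [le_kM|lt_Mk] := leqP k M; last first.
  by rewrite krawtchouk_factor_eq0 ?leq_addr // !mul0r rmorph0 !mul0r.
rewrite krawtchouk_factor_bin ?leq_addr // rmorph_sum !mulr_suml big_mkord.
by rewrite (big_ord_widen_cond M.+1 xpredT (fun l => F l k)).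
Qed.

End OneVariable.

(** * Expansion in several variables *)

Lemma big_ord_lift0_lt (R : nmodType) n (F : 'I_n.+1 -> R) (j : 'I_n) :
  \sum_(i < n.+1 | (i < lift ord0 j)%N) F i =
  F ord0 + \sum_(i < n | (i < j)%N) F (lift ord0 i).
Proof. by rewrite big_mkcond big_ord_recl /= -big_mkcond. Qed.

Lemma big_ord_gt_lift0 (R : nmodType) n (F : 'I_n.+1 -> R) (j : 'I_n) :
  \sum_(i < n.+1 | (lift ord0 j < i)%N) F i =
  \sum_(i < n | (j < i)%N) F (lift ord0 i).
Proof. by rewrite big_mkcond big_ord_recl /= add0r -big_mkcond. Qed.

Lemma big_ord_lt0 (R : nmodType) n (F : 'I_n.+1 -> R) :
  \sum_(i < n.+1 | (i < (ord0 : 'I_n.+1))%N) F i = 0.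
Proof. by rewrite big_pred0. Qed.

Lemma big_ord_gt0 (R : nmodType) n (F : 'I_n.+1 -> R) :
  \sum_(i < n.+1 | ((ord0 : 'I_n.+1) < i)%N) F i =
  \sum_(i < n) F (lift ord0 i).
Proof. by rewrite big_mkcond big_ord_recl /= add0r. Qed.

Section ManyVariables.
Variable R : realFieldType.

Definition krawtchouk_prod n (q r : 'I_n -> R) (x nu : 'I_n -> nat) (N : R) : R :=
  \prod_(j < n) krawtchouk_factor (q j) (r j) (nu j) (x j)
    (N - \sum_(i < n | (i < j)%N) (x i)%:R - \sum_(i < n | (j < i)%N) (nu i)%:R).

(** The first M contains only the later nu, while every later M_j contains x_0: passing to the tail
    replaces N by N - x_0. *)
Lemma krawtchouk_prod_recl n (q r : 'I_n.+1 -> R) (x nu : 'I_n.+1 -> nat) N :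
  krawtchouk_prod q r x nu N =
  krawtchouk_factor (q ord0) (r ord0) (nu ord0) (x ord0)
    (N - \sum_(i < n) (nu (lift ord0 i))%:R) *
  krawtchouk_prod (q \o lift ord0) (r \o lift ord0) (x \o lift ord0)
    (nu \o lift ord0) (N - (x ord0)%:R).
Proof.
rewrite /krawtchouk_prod big_ord_recl big_ord_lt0 big_ord_gt0 subr0.
congr (_ * _); apply: eq_bigr => j _ /=.
by rewrite big_ord_lift0_lt big_ord_gt_lift0 opprD addrA.
Qed.

(** Induction on the number of variables. If the later nu sum to at most X + y, the first M is a
    natural number, at least x_0 and below nu_0, so the first factor is 0; otherwise the tail
    product is 0. *)
Lemma krawtchouk_prod_eq0 n (q r : 'I_n -> R) (x nu : 'I_n -> nat) (y : nat) :
  (forall j, q j * r j = 1 + q j) ->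
  (\sum_j x j + y < \sum_j nu j)%N ->
  krawtchouk_prod q r x nu (\sum_j x j + y)%:R = 0.
Proof.
elim: n q r x nu => [|n IHn] q r x nu qr; first by rewrite !big_ord0.
rewrite krawtchouk_prod_recl !big_ord_recl -natr_sum.
set X := (\sum_(i < n) x _)%N; set K := (\sum_(i < n) nu _)%N => ltXK.
have [leK|ltK] := leqP K (X + y).
  rewrite -natrB; last by lia.
  by rewrite krawtchouk_factor_eq0 ?mul0r //; lia.
have -> : (x ord0 + X + y)%:R - (x ord0)%:R = (X + y)%:R :> R.
  by rewrite -addnA natrD addrC addKr.
by rewrite IHn ?mulr0 // => j; exact: qr.
Qed.

Variables (A : comNzRingType) (phi : {rmorphism R -> A}).

(** Prepends a value, so that a sum over exponent vectors splits along the first entry. *)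
Definition ffun_cons n (T : Type) (p : T * {ffun 'I_n -> T}) : {ffun 'I_n.+1 -> T} :=
  [ffun i => oapp p.2 p.1 (unlift ord0 i)].

Lemma ffun_cons0 n T (p : T * {ffun 'I_n -> T}) : ffun_cons p ord0 = p.1.
Proof. by rewrite ffunE unlift_none. Qed.

Lemma ffun_consS n T (p : T * {ffun 'I_n -> T}) i : ffun_cons p (lift ord0 i) = p.2 i.
Proof. by rewrite ffunE liftK. Qed.

Lemma big_ffun_recl n (T : finType) (F : {ffun 'I_n.+1 -> T} -> A) :
  \sum_f F f = \sum_f \sum_k F (ffun_cons (k, f)).
Proof.
rewrite exchange_big pair_bigA /= (reindex (@ffun_cons n T)) /=.
  by apply: eq_bigr => -[].
exists (fun f => (f ord0, [ffun i => f (lift ord0 i)])) => /= [[k f]|f] _.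
  by rewrite ffun_cons0; congr (_, _); apply/ffunP => i; rewrite ffunE ffun_consS.
apply/ffunP => i; case: (unliftP ord0 i) => [j|] ->.
  by rewrite ffun_consS ffunE.
by rewrite ffun_cons0.
Qed.

(* The factors are expanded starting from the last one: the exponent of
   [s - q j * t j] left by the later factors is [M_j - x j]. *)
Lemma expand_factors n (q r : 'I_n -> R) (x : 'I_n -> nat) (y B : nat)
    (t : 'I_n -> A) (s : A) :
  (forall j, q j * r j = 1 + q j) -> (\sum_j x j + y < B)%N ->
  (\prod_(j < n) (s - \sum_(i < n | (i < j)%N) phi (q i) * t i + t j) ^+ x j)
     * (s - \sum_(i < n) phi (q i) * t i) ^+ y =
  \sum_(f : {ffun 'I_n -> 'I_B})
    phi (krawtchouk_prod q r x (fun j => f j) (\sum_j x j + y)%:R / \prod_j (f j)`!%:R)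
      * \prod_j t j ^+ f j * s ^+ (\sum_j x j + y - \sum_j f j).
Proof.
elim: n q r x t s => [|n IHn] q r x t s qr ltB.
  rewrite big_ord0 big_ord0 mul1r subr0.
  have f0 : {ffun 'I_0 -> 'I_B} by apply: finfun => -[].
  rewrite (big_pred1 f0) => [|f]; last by apply/esym/eqP/ffunP => -[].
  by rewrite /krawtchouk_prod !big_ord0 divr1 rmorph1 !mul1r subn0.
have sumx : (\sum_j x j = x ord0 + \sum_(i < n) x (lift ord0 i))%N.
  by rewrite big_ord_recl.
move: ltB; rewrite {}sumx; set X := (\sum_(i < n) x _)%N => ltB.
rewrite big_ord_recl big_ord_lt0 subr0.
under eq_bigr do rewrite big_ord_lift0_lt opprD addrA.
rewrite big_ord_recl opprD addrA -mulrA.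
have ltB' : (\sum_(i < n) (x \o lift ord0) i + y < B)%N.
  by apply: leq_ltn_trans ltB; rewrite -addnA leq_addl.
(* For the tail, s - q_0 t_0 plays the role of s. *)
have /= -> := IHn (q \o lift ord0) (r \o lift ord0) (x \o lift ord0)
  (t \o lift ord0) (s - phi (q ord0) * t ord0) (fun j => qr _) ltB'.
rewrite big_ffun_recl mulr_sumr; apply: eq_bigr => f _.
rewrite -/X; set K := (\sum_j f j)%N.
have natX : (x ord0 + X + y)%:R - (x ord0)%:R = (X + y)%:R :> R.
  by rewrite -addnA natrD addrC addKr.
have sumf k : (\sum_(i < n) ffun_cons (k, f) (lift ord0 i) = K)%N.
  by apply: eq_bigr => i _; rewrite ffun_consS.
have kprodE k : krawtchouk_prod q r x (fun j => ffun_cons (k, f) j) (x ord0 + X + y)%:R =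
   krawtchouk_factor (q ord0) (r ord0) k (x ord0)
     ((x ord0 + X + y)%:R - K%:R) *
   krawtchouk_prod (q \o lift ord0) (r \o lift ord0) (x \o lift ord0) (fun j => f j) (X + y)%:R.
  rewrite krawtchouk_prod_recl natX -natr_sum sumf ffun_cons0; congr (_ * _).
  apply: eq_bigr => j _ /=; rewrite ffun_consS; congr (krawtchouk_factor _ _ _ _ (_ - _)).
  by apply: eq_bigr => i _; rewrite ffun_consS.
(* If K > X + y the exponent X + y - K is truncated, but then the tail product vanishes and both
   sides are 0. *)
have [leK|ltK] := leqP K (X + y); last first.
  have kprod0 : krawtchouk_prod (q \o lift ord0) (r \o lift ord0) (x \o lift ord0) (fun j => f j)
      (X + y)%:R = 0 by apply: krawtchouk_prod_eq0 ltK => j; exact: qr.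
  rewrite kprod0 mul0r rmorph0 !mul0r mulr0 big1 // => k _.
  by rewrite kprodE kprod0 mulr0 mul0r rmorph0 !mul0r.
have ltB2 : (x ord0 + (X + y - K) < B)%N by lia.
set P := phi _; set T := \prod_(j < n) _.
(* The power of s - q_0 t_0 left by the tail joins the first factor in a two-factor expansion. *)
transitivity (P * T * ((s + t ord0) ^+ x ord0 * (s - phi (q ord0) * t ord0) ^+ (X + y - K))).
  by ring.
rewrite (expand_two_factors (qr ord0) phi _ _ ltB2) mulr_sumr; apply: eq_bigr => k _.
rewrite kprodE !big_ord_recl ffun_cons0 sumf /=.
under [\prod_(i < n) (_`!)%:R]eq_bigr do rewrite ffun_consS.
under [\prod_(i < n) t _ ^+ _]eq_bigr do rewrite ffun_consS.
rewrite -natrB; last by lia.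
have -> : (x ord0 + (X + y - K) = x ord0 + X + y - K)%N by lia.
rewrite invfM mulrACA rmorphM -/P -/T.
have -> : (x ord0 + X + y - (k + K) = x ord0 + X + y - K - k)%N by lia.
ring.
Qed.

End ManyVariables.

(** * Points of the simplex as multi-indices *)

Section Simplex.
Variables (d N : nat).

Lemma mdeg_simplex (x : simplex d N) : mdeg x = N.
Proof. exact/eqP/(valP x). Qed.

Lemma simplex_inj (x y : simplex d N) : (x : 'X_{1..d.+1}) = y -> x = y.
Proof. by move=> /val_inj/val_inj. Qed.

Lemma eq_simplex (x y : simplex d N) : (x == y) = (x == y :> 'X_{1..d.+1}).
Proof. by apply/eqP/eqP => [->|/simplex_inj]. Qed.

Lemma simplexP (m : 'X_{1..d.+1}) : mdeg m = N -> exists x : simplex d N, x = m :> 'X_{1.. _}.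
Proof.
move=> degm; have ltm : (mdeg m < N.+1)%N by rewrite degm.
have degm' : mdeg (BMultinom ltm) == N by rewrite /= degm.
by exists (exist _ (BMultinom ltm) degm').
Qed.

End Simplex.

(** * The multinomial theorem *)

Section MultinomialTheorem.
Variable R : realFieldType.

Lemma mfactorial_gt0 k (m : 'X_{1..k}) : (0 < mfactorial m)%N.
Proof. by apply: prodn_gt0 => i; exact: fact_gt0. Qed.

Lemma mfactorial_neq0 k (m : 'X_{1..k}) : (mfactorial m)%:R != 0 :> R.
Proof. by rewrite pnatr_eq0 -lt0n mfactorial_gt0. Qed.

Lemma factorial_neq0 k : k`!%:R != 0 :> R.
Proof. by rewrite pnatr_eq0 -lt0n fact_gt0. Qed.

Lemma mfactorialDU k (m : 'X_{1..k}) i :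
  mfactorial (m + U_(i))%MM = ((m i).+1 * mfactorial m)%N.
Proof.
rewrite /mfactorial (bigD1 i) //= [in RHS](bigD1 i) //= mnmDE mnm1E eqxx addn1 factS mulnA.
by congr (_ * _)%N; apply: eq_bigr => j neq_ji; rewrite mnmDE mnm1E eq_sym (negPf neq_ji) addn0.
Qed.

(** By induction on N, multiplication by X_i contributes the coefficient at m - U_i, which is m_i
    N!/m!; these add up to |m| N!/m!. *)
Lemma mcoeff_exp_sumX k (N : nat) (m : 'X_{1..k}) :
  ((\sum_(i < k) 'X_i : {mpoly R[k]}) ^+ N)@_m =
  if mdeg m == N then N`!%:R / (mfactorial m)%:R else 0.
Proof.
elim: N m => [|N IHN] m.
  rewrite expr0 mcoeff1 mdeg_eq0; case: eqP => [->|//].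
  by rewrite /mfactorial big1 ?divr1 // => i _; rewrite mnm0E.
rewrite exprSr mulr_sumr raddf_sum /=.
transitivity (\sum_(i < k)
  if mdeg m == N.+1 then (m i)%:R * (N`!%:R / (mfactorial m)%:R) else 0 : R).
  apply: eq_bigr => i _.
  have [mi0|mi_neq0] := eqVneq (m i) 0%N.
    rewrite mi0 mul0r if_same; apply: memN_msupp_eq0.
    rewrite (perm_mem (msuppMX _ _)); apply/mapP => -[m' _ mE].
    by move: mi0; rewrite mE mnmDE mnm1E eqxx.
  have mE : m = (U_(i) + (m - U_(i)))%MM by rewrite addmC submK // lep1mP.
  move: (m - U_(i))%MM mE => m' ->.
  rewrite mcoeffMX IHN mdegD mdeg1 eqSS.
  case: eqP => // _; rewrite addmC mfactorialDU mnmDE mnm1E eqxx addn1 natrM invfM.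
  by rewrite [RHS]mulrCA mulVKf // pnatr_eq0.
case: eqP => [degm|_]; last by rewrite big1.
by rewrite -mulr_suml -natr_sum -mdegE degm factS natrM mulrA.
Qed.

Variables (A : comNzRingType) (phi : {rmorphism R -> A}).

(** Coefficients are carried along [phi] because the y_i will be polynomials, in one and then two
    sets of variables. *)
Lemma multinomial_theorem d N (y : 'I_d.+1 -> A) :
  (\sum_i y i) ^+ N =
  \sum_(x : simplex d N) phi (N`!%:R / (mfactorial x)%:R) * \prod_i y i ^+ x i.
Proof.
have -> : \sum_i y i = mmap phi y (\sum_i 'X_i).
  by rewrite raddf_sum; apply: eq_bigr => i _; rewrite /= mmapX mmap1U.
rewrite -rmorphXn /=.
have -> : (\sum_(i < d.+1) 'X_i) ^+ N =
    \sum_(x : simplex d N) (N`!%:R / (mfactorial x)%:R) *: 'X_[R, x].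
  apply/mpolyP => m; rewrite mcoeff_exp_sumX raddf_sum /=.
  under eq_bigr do rewrite mcoeffZ mcoeffX.
  case: eqP => [/simplexP[x0 <-]|neq_degm].
    rewrite (bigD1 x0) //= eqxx mulr1 big1 ?addr0 // => x neq_x.
    by rewrite -eq_simplex (negPf neq_x) mulr0.
  rewrite big1 // => x _; case: eqP => [xE|_]; last by rewrite mulr0.
  by case: neq_degm; rewrite -xE mdeg_simplex.
by rewrite raddf_sum; apply: eq_bigr => x _; rewrite /= mmapZ mmapX.
Qed.

End MultinomialTheorem.

(** * Dropping the last coordinate *)

Lemma big_ord_lift_max (T : Type) (idx : T) (op : Monoid.com_law idx) n (F : 'I_n.+1 -> T) :
  \big[op/idx]_i F i = op (F ord_max) (\big[op/idx]_(i < n) F (lift ord_max i)).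
Proof. by rewrite (bigD1_ord ord_max). Qed.

Lemma val_lift_max n (i : 'I_n) : lift ord_max i = i :> nat.
Proof. exact: lift_max. Qed.

Section Truncation.
Variable d : nat.

(** Identifies [simplex d N] with the multi-indices of length d and weight at most N, so that points
    of the simplex can also index the K_nu. *)
Definition mtrunc (m : 'X_{1..d.+1}) : 'X_{1..d} := [multinom m (lift ord_max j) | j < d].

Lemma mtruncE (m : 'X_{1..d.+1}) j : mtrunc m j = m (lift ord_max j).
Proof. exact: mnmE. Qed.

Lemma mdeg_mtrunc (m : 'X_{1..d.+1}) : mdeg m = (m ord_max + mdeg (mtrunc m))%N.
Proof.
rewrite !mdegE big_ord_lift_max; congr (_ + _)%N.
by apply: eq_bigr => j _; rewrite mtruncE.
Qed.

Lemma mfactorial_mtrunc (m : 'X_{1..d.+1}) :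
  mfactorial m = ((m ord_max)`! * mfactorial (mtrunc m))%N.
Proof.
rewrite /mfactorial big_ord_lift_max; congr (_ * _)%N.
by apply: eq_bigr => j _; rewrite mtruncE.
Qed.

Lemma simplex_max N (x : simplex d N) : x ord_max = (N - mdeg (mtrunc x))%N.
Proof. by have := mdeg_simplex x; rewrite mdeg_mtrunc; lia. Qed.

Lemma mtrunc_inj N (x y : simplex d N) : mtrunc x = mtrunc y -> x = y.
Proof.
move=> eq_xy; apply/simplex_inj/mnmP => i; case: (unliftP ord_max i) => [j|] ->.
  by rewrite -!mtruncE eq_xy.
by rewrite !simplex_max eq_xy.
Qed.

Lemma mdeg_mtrunc_le N (x : simplex d N) : (mdeg (mtrunc x) <= N)%N.
Proof. by have := mdeg_simplex x; rewrite mdeg_mtrunc; lia. Qed.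

Lemma mtruncP N (nu : 'X_{1..d}) : (mdeg nu <= N)%N ->
  exists x : simplex d N, mtrunc x = nu.
Proof.
move=> le_nu; pose m : 'X_{1..d.+1} :=
  [multinom oapp nu (N - mdeg nu)%N (unlift ord_max i) | i < d.+1].
have truncm : mtrunc m = nu by apply/mnmP => j; rewrite mtruncE mnmE liftK.
have degm : mdeg m = N by rewrite mdeg_mtrunc truncm mnmE unlift_none /= subnK.
by have [x xE] := simplexP degm; exists x; rewrite xE.
Qed.

Lemma sum_simplex N (x : simplex d N) : (\sum_(j < d) x (lift ord_max j) + x ord_max)%N = N.
Proof. by have := mdeg_simplex x; rewrite mdegE big_ord_lift_max addnC. Qed.

End Truncation.

(** * The generating function of the Krawtchouk polynomials *)

Section GeneratingFunction.
Variables (R : realFieldType) (d : nat) (rho : 'I_d -> R).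

Let q (j : 'I_d) : R := rho j / (1 - \sum_(i < d | (i <= j)%N) rho i).
Let r (j : 'I_d) : R := (1 - \sum_(i < d | (i < j)%N) rho i) / rho j.

(* Together with the constant vector 1, the columns of [ortho_coef] form an
   orthogonal basis of R^(d+1) for the weight [rho_bold rho]. *)
Definition ortho_coef (i : 'I_d.+1) (j : 'I_d) : R :=
  if (i < j)%N then 0 else if i == j :> nat then 1 else - q j.

Definition ortho_norm (j : 'I_d) : R :=
  \sum_i rho_bold rho i * (ortho_coef i j * ortho_coef i j).

Definition ortho_form (i : 'I_d.+1) : {mpoly R[d]} :=
  1 + \sum_j ortho_coef i j *: 'X_j.

Definition krawtchouk_gen (x : 'X_{1..d.+1}) : {mpoly R[d]} :=
  \prod_i ortho_form i ^+ x i.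

Hypothesis rho01 : forall j : 'I_d, 0 < rho j < 1.
Hypothesis sum_rho_lt1 : \sum_j rho j < 1.

Lemma rho_gt0 j : 0 < rho j. Proof. by case/andP: (rho01 j). Qed.

Lemma tail_gt0 (P : pred 'I_d) : 0 < 1 - \sum_(i | P i) rho i.
Proof.
rewrite subr_gt0; apply: le_lt_trans sum_rho_lt1.
rewrite [leRHS](bigID P) /= lerDl; apply: sumr_ge0 => i _; exact/ltW/rho_gt0.
Qed.

Lemma rho_bold_lift j : rho_bold rho (lift ord_max j) = rho j.
Proof. by rewrite /rho_bold liftK. Qed.

Lemma rho_bold_max : rho_bold rho ord_max = 1 - \sum_j rho j.
Proof. by rewrite /rho_bold unlift_none. Qed.

Lemma rho_bold_gt0 i : 0 < rho_bold rho i.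
Proof.
case: (unliftP ord_max i) => [j|] ->;
  by rewrite ?rho_bold_lift ?rho_bold_max ?rho_gt0 ?(tail_gt0 xpredT).
Qed.

Lemma sum_rho_bold : \sum_i rho_bold rho i = 1.
Proof.
rewrite big_ord_lift_max /= rho_bold_max; under eq_bigr do rewrite rho_bold_lift.
by rewrite subrK.
Qed.

Lemma sum_leq_split (j : 'I_d) :
  \sum_(i < d | (i <= j)%N) rho i = rho j + \sum_(i < d | (i < j)%N) rho i.
Proof.
rewrite (bigD1 j) //=; congr (_ + _); apply: eq_bigl => i.
by rewrite andbC -ltn_neqAle.
Qed.

Lemma ortho_ratio j : q j * r j = 1 + q j.
Proof.
have := tail_gt0 (fun i : 'I_d => (i <= j)%N).
rewrite /q /r sum_leq_split => /lt0r_neq0 A_neq0; have /lt0r_neq0 rho_neq0 := rho_gt0 j.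
by field; rewrite rho_neq0 A_neq0.
Qed.

Lemma ortho_coef_lift (i j : 'I_d) :
  ortho_coef (lift ord_max i) j = if (i < j)%N then 0 else if i == j then 1 else - q j.
Proof. by rewrite /ortho_coef val_lift_max. Qed.

Lemma ortho_coef_diag j : ortho_coef (lift ord_max j) j = 1.
Proof. by rewrite ortho_coef_lift ltnn eqxx. Qed.

Lemma ortho_coef_max j : ortho_coef ord_max j = - q j.
Proof. by rewrite /ortho_coef /= ltnNge ltnW //= gtn_eqF. Qed.

(** The rows after j, the last one included, have total weight 1 - sum_(i <= j) rho_i; times q_j
    this is rho_j, the contribution of row j. *)
Lemma ortho_coef_sum j : \sum_i rho_bold rho i * ortho_coef i j = 0.
Proof.
rewrite big_ord_lift_max /= rho_bold_max ortho_coef_max.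
under eq_bigr do rewrite rho_bold_lift ortho_coef_lift.
rewrite [X in _ * _ + X](bigD1 j) //= ltnn eqxx mulr1.
rewrite [X in _ * _ + (_ + X)](bigID (fun i : 'I_d => (i < j)%N)) /=.
rewrite [X in _ + (_ + (X + _))]big1 => [|i /andP[_ ->]]; last by rewrite mulr0.
under [X in _ + (_ + (_ + X))]eq_bigr => i /andP[/negPf-> /negPf->] do [].
rewrite -mulr_suml add0r.
have /lt0r_neq0 A_neq0 := tail_gt0 (fun i : 'I_d => (i <= j)%N).
rewrite [X in 1 - X](bigID (fun i : 'I_d => (i <= j)%N)) /=.
have -> : \sum_(i < d | (i != j) && ~~ (i < j)%N) rho i = \sum_(i < d | ~~ (i <= j)%N) rho i.
  by apply: eq_bigl => i; rewrite -leqNgt -ltnNge [RHS]ltn_neqAle eq_sym.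
by rewrite /q; field.
Qed.

(** For j < k, column k lives on the rows i >= k, where column j has the constant value - q_j; the
    sum is then a multiple of [ortho_coef_sum]. *)
Lemma ortho_coef_orthogonal j k :
  \sum_i rho_bold rho i * (ortho_coef i j * ortho_coef i k) =
  if j == k then ortho_norm j else 0.
Proof.
case: eqP => [->//|/eqP neq_jk].
wlog lt_jk : j k neq_jk / (j < k)%N.
  move=> W; case: (ltngtP j k) => [|lt_kj|/val_inj eq_jk]; first exact: W.
    by under eq_bigr do rewrite [ortho_coef _ j * _]mulrC; rewrite W // eq_sym.
  by rewrite eq_jk eqxx in neq_jk.
transitivity (\sum_i - q j * (rho_bold rho i * ortho_coef i k)); last first.
  by rewrite -mulr_sumr ortho_coef_sum mulr0.
apply: eq_bigr => i _; rewrite /ortho_coef.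
case: (ltnP i k) => [_|le_ki]; first by rewrite !mulr0.
have lt_ji := leq_trans lt_jk le_ki.
by rewrite ltnNge ltnW //= gtn_eqF // mulrCA.
Qed.

Lemma ortho_norm_gt0 j : 0 < ortho_norm j.
Proof.
rewrite /ortho_norm (bigD1 (lift ord_max j)) //= ltr_pwDl //.
  by rewrite ortho_coef_diag !mulr1 rho_bold_gt0.
by apply: sumr_ge0 => i _; rewrite mulr_ge0 -?expr2 ?sqr_ge0 // ltW ?rho_bold_gt0.
Qed.

(** This is [expand_factors] at s = 1 with the variables of the polynomial ring for t. *)
Lemma mcoeff_krawtchouk_gen N (x : simplex d N) (nu : 'X_{1..d}) :
  (krawtchouk_gen x)@_nu =
  krawtchouk_prod q r (fun j => x (lift ord_max j)) nu N%:R / (mfactorial nu)%:R.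
Proof.
have formE i : ortho_form (lift ord_max i) =
    1 - \sum_(k < d | (k < i)%N) (q k)%:MP * 'X_k + 'X_i.
  rewrite /ortho_form (bigD1 i) //= ortho_coef_diag scale1r.
  rewrite [X in 1 - X]big_mkcond -addrA -sumrN [X in _ = _ + X]addrC /=; congr (_ + (_ + _)).
  rewrite big_mkcond; apply: eq_bigr => k _.
  rewrite ortho_coef_lift [k == i]eq_sym.
  case: ltngtP => [lt_ik|lt_ki|/val_inj->]; rewrite ?eqxx ?scale0r ?if_same ?oppr0 //.
  have neq_ik : i != k by rewrite neq_ltn lt_ki orbT.
  by rewrite neq_ik (negPf neq_ik) mul_mpolyC scaleNr.
have formMax : ortho_form ord_max = 1 - \sum_(k < d) (q k)%:MP * 'X_k.
  rewrite /ortho_form -sumrN; congr (_ + _); apply: eq_bigr => k _.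
  by rewrite ortho_coef_max mul_mpolyC scaleNr.
(* B exceeds N, as the expansion requires, and every nu_j, so that nu itself is among the index
   functions. *)
pose B := (maxn N (mdeg nu)).+1.
have lt_B : (\sum_(j < d) x (lift ord_max j) + x ord_max < B)%N.
  by rewrite sum_simplex ltnS leq_maxl.
rewrite /krawtchouk_gen big_ord_lift_max /= formMax.
under eq_bigr do rewrite formE.
rewrite mulrC (expand_factors (@mpolyC d R) _ _ ortho_ratio lt_B) sum_simplex.
rewrite raddf_sum /=.
have lt_nu j : (nu j < B)%N.
  by rewrite ltnS leq_max mdegE (bigD1 j) //= leq_addr orbT.
under eq_bigr => f _.
  rewrite expr1n mulr1 mcoeffCM.
  have -> : \prod_(j < d) 'X_j ^+ f j = 'X_[R, [multinom (f j : nat) | j < d]].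
    by rewrite mpolyXE_id; apply: eq_bigr => j _; rewrite mnmE.
  rewrite mcoeffX; over.
pose f0 : {ffun 'I_d -> 'I_B} := [ffun j => Ordinal (lt_nu j)].
rewrite (bigD1 f0) //= [X in _ + X]big1 ?addr0 => [|f neq_f]; last first.
  case: eqP => [nuE|_]; last by rewrite mulr0.
  case/eqP: neq_f; apply/ffunP => j; apply: val_inj.
  by rewrite ffunE /= -nuE mnmE.
have f0E j : f0 j = nu j :> nat by rewrite ffunE.
have -> : [multinom (f0 j : nat) | j < d] = nu by apply/mnmP => j; rewrite mnmE f0E.
rewrite eqxx mulr1 /mfactorial natr_prod; congr (_ / _); last first.
  by apply: eq_bigr => j _; rewrite f0E.
apply: eq_bigr => j _; rewrite f0E; congr (krawtchouk_factor _ _ _ _ (_ - _)).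
by apply: eq_bigr => i _; rewrite f0E.
Qed.

Lemma mcoeff_krawtchouk_gen_eq0 N (x : simplex d N) (nu : 'X_{1..d}) :
  (N < mdeg nu)%N -> (krawtchouk_gen x)@_nu = 0.
Proof.
rewrite mcoeff_krawtchouk_gen => lt_nu.
have -> : N%:R = (\sum_(j < d) x (lift ord_max j) + x ord_max)%:R :> R by rewrite sum_simplex.
by rewrite krawtchouk_prod_eq0 ?mul0r //; [exact: ortho_ratio|rewrite sum_simplex -mdegE].
Qed.

Lemma krawtchouk_mcoeff N nu (x : simplex d N) :
  krawtchouk rho N nu x = (-1) ^+ mdeg nu / poch (- N%:R) (mdeg nu) *
    ((mfactorial nu)%:R * (krawtchouk_gen x)@_nu).
Proof.
rewrite mcoeff_krawtchouk_gen [(mfactorial nu)%:R * _]mulrC divfK ?mfactorial_neq0 //.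
by rewrite ffunE.
Qed.

End GeneratingFunction.

(** * Moments of factorial monomials and of generating functions *)

Section Moments.
Variables (R : realFieldType) (d : nat).

Lemma mono_ffact N (alpha : 'X_{1..d.+1}) (x : simplex d N) :
  (mono N alpha : {ffun simplex d N -> R}) x = (\prod_i (x i ^_ alpha i))%:R.
Proof.
rewrite ffunE natr_prod; under eq_bigr do rewrite poch_opp_nat.
by rewrite big_split /= prodrXr -mdegE mulrA -exprMn mulrNN mulr1 expr1n mul1r.
Qed.

Lemma ffact_ratio (N n : nat) : (n <= N)%N -> N`!%:R / (N - n)`!%:R = (N ^_ n)%:R :> R.
Proof. by move=> le_nN; rewrite -(ffact_fact le_nN) natrM mulfK ?factorial_neq0. Qed.

Section Comm.
Variables (A : comNzRingType) (phi : {rmorphism R -> A}).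

(** For x >= alpha the falling factorials turn 1/x! into 1/(x - alpha)!, and for other x they
    vanish; the substitution x = alpha + z leaves the multinomial theorem in degree N - n. *)
Lemma sum_mono N n (alpha : simplex d n) (y : 'I_d.+1 -> A) : (n <= N)%N ->
  \sum_(x : simplex d N) phi (N`!%:R / (mfactorial x)%:R * (mono N alpha : {ffun _ -> R}) x)
     * \prod_i y i ^+ x i =
  phi (N ^_ n)%:R * \prod_i y i ^+ alpha i * (\sum_i y i) ^+ (N - n).
Proof.
move=> le_nN; rewrite (multinomial_theorem phi) mulr_sumr.
pose F (m : 'X_{1..d.+1}) : A :=
  phi (N`!%:R / (mfactorial m)%:R * (\prod_i (m i ^_ alpha i))%:R) * \prod_i y i ^+ m i.
transitivity (\sum_(z : simplex d (N - n)) F (alpha + multinom_of_simplex z)%MM); last first.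
  refine (eq_bigr _ (fun (z : simplex d (N - n)) Pz => _)); clear Pz.
  rewrite /F mulrACA -rmorphM /= -big_split /=.
  congr (phi _ * _); last by apply: eq_bigr => i _; rewrite mnmDE exprD.
  have -> : mfactorial (alpha + multinom_of_simplex z)%MM =
      (\prod_i ((alpha + multinom_of_simplex z)%MM i ^_ alpha i)
        * mfactorial (multinom_of_simplex z))%N.
    rewrite /mfactorial -big_split /=; apply: eq_bigr => i _.
    by rewrite mnmDE -(ffact_fact (leq_addr (z i) (alpha i))) addKn.
  rewrite -ffact_ratio // natrM.
  have P_neq0 : (\prod_i ((alpha + multinom_of_simplex z)%MM i ^_ alpha i))%:R != 0 :> R.
    by rewrite pnatr_eq0 -lt0n prodn_gt0 // => i; rewrite ffact_gt0 mnmDE leq_addr.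
  by field; rewrite P_neq0 mfactorial_neq0 factorial_neq0.
(* Reindexing by a double sum: each z has exactly one x = alpha + z, and each x >= alpha exactly one
   z. *)
transitivity (\sum_(z : simplex d (N - n))
    \sum_(x : simplex d N |
      multinom_of_simplex x == (alpha + multinom_of_simplex z)%MM) F x).
  rewrite (exchange_big_dep xpredT) //=.
  refine (eq_bigr _ (fun (x : simplex d N) Px => _)); clear Px.
  rewrite mono_ffact -/(F x).
  have [le_ax|/mnm_lepP nle_ax] := boolP (alpha <= x)%MM; last first.
    have Fx0 : F x = 0.
      have /forallPn[i lt_xa] : ~~ [forall i, (alpha i <= x i)%N].
        by apply/negP => /forallP.
      by rewrite /F (bigD1 i) //= ffact_small ?ltnNge // mul0n mulr0 rmorph0 mul0r.
    by rewrite Fx0 big1.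
  have degz : mdeg (x - alpha)%MM = (N - n)%N.
    by have := congr1 (@mdeg _) (submK le_ax); rewrite mdegD !mdeg_simplex; lia.
  have [z zE] := simplexP degz.
  rewrite (big_pred1 z) // => z' /=; rewrite [RHS]eq_simplex zE.
  by rewrite -[RHS](eqm_add2l alpha) [X in _ = (_ == X)]addmC submK // eq_sym.
refine (eq_bigr _ (fun (z : simplex d (N - n)) Pz => _)); clear Pz.
have degx : mdeg (alpha + multinom_of_simplex z)%MM = N by rewrite mdegD !mdeg_simplex subnKC.
have [x xE] := simplexP degx.
rewrite -xE (big_pred1 x) // => x'; exact/esym/eq_simplex.
Qed.


(** Both sides are the coefficient of t^nu in (sum_i y_i w_i(t))^N. The left expands in the terms
    y_i w_i; the right first collects powers of t into sum_i y_i + sum_j z_j t_j, the constant term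
    taking the last index. *)
Lemma sum_krawtchouk_gen (rho : 'I_d -> R) N nu (y : 'I_d.+1 -> A) : (mdeg nu <= N)%N ->
  \sum_(x : simplex d N)
    phi (N`!%:R / (mfactorial x)%:R * (krawtchouk_gen rho x)@_nu) * \prod_i y i ^+ x i =
  phi ((N ^_ mdeg nu)%:R / (mfactorial nu)%:R)
    * \prod_j (\sum_i phi (ortho_coef rho i j) * y i) ^+ nu j
    * (\sum_i y i) ^+ (N - mdeg nu).
Proof.
move=> le_nu.
pose z j := \sum_i phi (ortho_coef rho i j) * y i.
pose Y i : {mpoly A[d]} := (y i)%:MP * map_mpoly phi (ortho_form rho i).
pose Z i : {mpoly A[d]} :=
  if unlift ord_max i is Some j then (z j)%:MP * 'X_j else (\sum_i y i)%:MP.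
have sumYZ : \sum_i Y i = \sum_i Z i.
  rewrite [RHS]big_ord_lift_max /= /Z unlift_none.
  under [in RHS]eq_bigr do rewrite liftK.
  transitivity (\sum_i ((y i)%:MP
      + \sum_j (phi (ortho_coef rho i j) * y i)%:MP * 'X_j : {mpoly A[d]})).
    apply: eq_bigr => i _; rewrite /Y /ortho_form rmorphD rmorph1 mulrDr mulr1.
    congr (_ + _); rewrite rmorph_sum mulr_sumr; apply: eq_bigr => j _.
    by rewrite /= map_mpolyZ map_mpolyX -mul_mpolyC mulrA -mpolyCM [y i * _]mulrC.
  rewrite big_split /= raddf_sum exchange_big /=; congr (_ + _).
  by apply: eq_bigr => j _; rewrite /z raddf_sum mulr_suml.
have /(congr1 (mcoeff nu)) : (\sum_i Y i) ^+ N = (\sum_i Z i) ^+ N by rewrite sumYZ.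
rewrite !(multinomial_theorem (@mpolyC d A \o phi)) !raddf_sum /=.
have YE (x : simplex d N) : \prod_i Y i ^+ x i =
    (\prod_i y i ^+ x i)%:MP * map_mpoly phi (krawtchouk_gen rho x).
  rewrite !rmorph_prod -big_split; apply: eq_bigr => i _ /=.
  by rewrite exprMn !rmorphXn.
have ZE (x : simplex d N) : \prod_i Z i ^+ x i =
    ((\sum_i y i) ^+ (N - mdeg (mtrunc x)) * \prod_j z j ^+ mtrunc x j)%:MP * 'X_[mtrunc x].
  rewrite big_ord_lift_max /= {1}/Z unlift_none mpolyCM rmorphXn -simplex_max -mulrA.
  congr (_ * _); rewrite rmorph_prod mpolyXE_id -big_split; apply: eq_bigr => j _ /=.
  by rewrite /Z liftK exprMn rmorphXn mtruncE.
under eq_bigr do rewrite YE !mcoeffCM mcoeff_map_mpoly.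
under [in RHS]eq_bigr do rewrite ZE !mcoeffCM mcoeffX.
have [m mE] := mtruncP le_nu.
rewrite [RHS](bigD1 m) //= mE eqxx [X in _ + X]big1 ?addr0 => [|x neq_x]; last first.
  case: eqP => [xE|_]; last by rewrite !mulr0.
  by case/eqP: neq_x; apply: mtrunc_inj; rewrite mE.
under eq_bigr do rewrite mulrA mulrAC -rmorphM.
move=> ->; rewrite mulr1 -[RHS]mulrA [in RHS](mulrC (\prod_j _)); congr (phi _ * _).
rewrite mfactorial_mtrunc simplex_max mE natrM -(ffact_ratio le_nu).
by field; rewrite mfactorial_neq0 factorial_neq0.
Qed.

End Comm.

Variables (rho : 'I_d -> R).
Hypothesis rho01 : forall j : 'I_d, 0 < rho j < 1.
Hypothesis sum_rho_lt1 : \sum_j rho j < 1.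

(** With this choice, y^x is the weight rho^x times the generating function at x, in a fresh set of
    variables. *)
Let y i : {mpoly R[d]} := (rho_bold rho i)%:MP * ortho_form rho i.

Lemma sum_rho_ortho_form : \sum_i y i = 1.
Proof.
transitivity (\sum_i ((rho_bold rho i)%:MP
    + \sum_j (rho_bold rho i * ortho_coef rho i j)%:MP * 'X_j : {mpoly R[d]})).
  apply: eq_bigr => i _; rewrite /y /ortho_form mulrDr mulr1; congr (_ + _).
  rewrite mulr_sumr; apply: eq_bigr => j _.
  by rewrite -mul_mpolyC mulrA -mpolyCM.
rewrite big_split /= -raddf_sum /= sum_rho_bold mpolyC1 exchange_big /= big1 ?addr0 // => j _.
by rewrite -mulr_suml -raddf_sum /= ortho_coef_sum // mpolyC0 mul0r.
Qed.

Lemma sum_ortho_coef_form j :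
  \sum_i (ortho_coef rho i j)%:MP * y i = (ortho_norm rho j)%:MP * 'X_j.
Proof.
transitivity (\sum_i ((rho_bold rho i * ortho_coef rho i j)%:MP
    + \sum_k (rho_bold rho i * (ortho_coef rho i j * ortho_coef rho i k))%:MP * 'X_k
    : {mpoly R[d]})).
  apply: eq_bigr => i _; rewrite /y /ortho_form.
  rewrite mulrA -mpolyCM mulrDr mulr1 [_ * rho_bold _ _]mulrC.
  congr (_ + _); rewrite mulr_sumr; apply: eq_bigr => k _.
  by rewrite -mul_mpolyC mulrA -mpolyCM mulrA.
rewrite big_split /= -raddf_sum /= ortho_coef_sum // mpolyC0 add0r exchange_big /=.
under eq_bigr do rewrite -mulr_suml -raddf_sum /= ortho_coef_orthogonal //.
rewrite (bigD1 j) //= eqxx big1 ?addr0 // => k neq_kj.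
by rewrite eq_sym (negPf neq_kj) mpolyC0 mul0r.
Qed.

Lemma prod_rho_ortho_form (x : 'X_{1..d.+1}) :
  \prod_i y i ^+ x i = (weight (rho_bold rho) x)%:MP * krawtchouk_gen rho x.
Proof.
rewrite rmorph_prod -big_split; apply: eq_bigr => i _ /=.
by rewrite exprMn rmorphXn.
Qed.

(** Coefficient of t^nu in [sum_mono] at this y; the y_i sum to 1, so the last power disappears. *)
Lemma mono_krawtchouk_gen N n (alpha : simplex d n) nu : (n <= N)%N ->
  \sum_(x : simplex d N) N`!%:R / (mfactorial x)%:R * (mono N alpha : {ffun _ -> R}) x
     * weight (rho_bold rho) x * (krawtchouk_gen rho x)@_nu =
  (N ^_ n)%:R * weight (rho_bold rho) alpha * (krawtchouk_gen rho alpha)@_nu.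
Proof.
move=> le_nN; have := congr1 (mcoeff nu) (sum_mono (@mpolyC d R) alpha y le_nN).
rewrite sum_rho_ortho_form expr1n mulr1 prod_rho_ortho_form mulrA -mpolyCM mcoeffCM => <-.
rewrite raddf_sum; apply: eq_bigr => x _ /=.
by rewrite prod_rho_ortho_form mulrA -mpolyCM mcoeffCM.
Qed.

(** Coefficient of t^mu in [sum_krawtchouk_gen] at this y: the forms in y become multiples of single
    variables, so only the monomial t^nu survives. *)
Lemma krawtchouk_gen_orthogonal N nu mu : (mdeg nu <= N)%N ->
  \sum_(x : simplex d N) N`!%:R / (mfactorial x)%:R * (krawtchouk_gen rho x)@_nu
     * weight (rho_bold rho) x * (krawtchouk_gen rho x)@_mu =
  (N ^_ mdeg nu)%:R / (mfactorial nu)%:R * weight (ortho_norm rho) nu * (nu == mu)%:R.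
Proof.
move=> le_nu; have := congr1 (mcoeff mu) (sum_krawtchouk_gen (@mpolyC d R) rho y le_nu).
under [in RHS]eq_bigr do rewrite sum_ortho_coef_form exprMn.
rewrite sum_rho_ortho_form expr1n mulr1 big_split /= -mpolyXE_id.
under [in RHS]eq_bigr do rewrite -rmorphXn.
rewrite -rmorph_prod /= mulrA -mpolyCM mcoeffCM mcoeffX => <-.
rewrite raddf_sum; apply: eq_bigr => x _ /=.
by rewrite prod_rho_ortho_form mulrA -mpolyCM mcoeffCM.
Qed.

End Moments.

(** A one-sided inverse of a square matrix is two-sided; this will turn orthogonality into
    completeness. *)
Lemma inverse_sumC (R : comUnitRingType) (I : finType) (F G : I -> I -> R) :
  (forall i k, \sum_j F i j * G j k = (i == k)%:R) ->
  forall i k, \sum_j G i j * F j k = (i == k)%:R.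
Proof.
move=> FG i k.
pose mx (H : I -> I -> R) : 'M[R]_#|I| := \matrix_(a, b) H (enum_val a) (enum_val b).
have mulE H1 H2 a b :
    (mx H1 *m mx H2) a b = \sum_j H1 (enum_val a) j * H2 j (enum_val b).
  rewrite mxE [RHS](reindex (@enum_val I predT)) /=; last exact/onW_bij/enum_val_bij.
  by apply: eq_bigr => j _; rewrite !mxE.
have FG1 : mx F *m mx G = 1%:M.
  by apply/matrixP => a b; rewrite mulE FG mxE (inj_eq enum_val_inj).
have := congr1 (fun M : 'M_#|I| => M (enum_rank i) (enum_rank k)) (mulmx1C FG1).
by rewrite mulE !enum_rankK mxE (inj_eq enum_rank_inj).
Qed.

(** * Degrees of polynomial functions on the simplex *)

Section PolynomialFunctions.
Variables (R : realFieldType) (d N : nat).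

(* For a finite function, [deg_le k] is convertible to [is_poly_lt k.+1]. *)
Definition deg_le k (F : simplex d N -> R) : Prop :=
  exists2 p : {mpoly R[d]}, (msize p <= k.+1)%N &
    forall x, F x = p.@[fun j => (x (lift ord_max j))%:R].

Lemma deg_le_const k c : deg_le k (fun=> c).
Proof.
exists c%:MP => [|x]; last by rewrite mevalC.
by rewrite msizeC; case: (c != 0).
Qed.

Lemma deg_le_coord j : deg_le 1 (fun x => (x (lift ord_max j))%:R).
Proof. by exists 'X_j => [|x]; rewrite ?msizeX ?mdeg1 ?mevalXU. Qed.

Lemma deg_leD k F G : deg_le k F -> deg_le k G -> deg_le k (fun x => F x + G x).
Proof.
move=> [p sp Fp] [q sq Gq]; exists (p + q) => [|x]; last by rewrite Fp Gq mevalD.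
by apply: leq_trans (msizeD_le _ _) _; rewrite geq_max sp.
Qed.

Lemma deg_leM k l F G : deg_le k F -> deg_le l G -> deg_le (k + l) (fun x => F x * G x).
Proof.
move=> [p sp Fp] [q sq Gq]; exists (p * q) => [|x]; last by rewrite Fp Gq mevalM.
have [->|p_neq0] := eqVneq p 0; first by rewrite mul0r msize0.
have [->|q_neq0] := eqVneq q 0; first by rewrite mulr0 msize0.
rewrite msizeM // -subn1 leq_subLR add1n.
by apply: leq_trans (leq_add sp sq) _; rewrite addSn addnS.
Qed.

Lemma deg_leZ k c F : deg_le k F -> deg_le k (fun x => c * F x).
Proof. by move=> Fk; apply: (deg_leM (deg_le_const 0 c)). Qed.

Lemma deg_leZr k c F : deg_le k F -> deg_le k (fun x => F x * c).
Proof. by move=> Fk; rewrite -[k]addn0; apply: deg_leM Fk (deg_le_const 0 c). Qed.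

Lemma deg_leW k l F : (k <= l)%N -> deg_le k F -> deg_le l F.
Proof. by move=> le_kl [p sp Fp]; exists p => //; apply: leq_trans sp _. Qed.

Lemma eq_deg_le k F G : F =1 G -> deg_le k F -> deg_le k G.
Proof. by move=> eqFG [p sp Fp]; exists p => // x; rewrite -eqFG. Qed.

Lemma deg_le_sum k (I : Type) (s : seq I) (P : pred I) (F : I -> simplex d N -> R) :
  (forall i, P i -> deg_le k (F i)) -> deg_le k (fun x => \sum_(i <- s | P i) F i x).
Proof.
move=> Fk; elim: s => [|i s IHs].
  by apply: eq_deg_le (deg_le_const k 0) => x; rewrite big_nil.
have [Pi|nPi] := boolP (P i).
  by apply: eq_deg_le (deg_leD (Fk i Pi) IHs) => x; rewrite big_cons Pi.
by apply: eq_deg_le IHs => x; rewrite big_cons (negPf nPi).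
Qed.

Lemma deg_le_prod (I : Type) (s : seq I) (k : I -> nat) (F : I -> simplex d N -> R) :
  (forall i, deg_le (k i) (F i)) ->
  deg_le (\sum_(i <- s) k i) (fun x => \prod_(i <- s) F i x).
Proof.
move=> Fk; elim: s => [|i s IHs].
  by rewrite big_nil; apply: eq_deg_le (deg_le_const 0 1) => x; rewrite big_nil.
rewrite big_cons; apply: eq_deg_le (deg_leM (Fk i) IHs) => x.
by rewrite big_cons.
Qed.

Lemma deg_le_poch k F : deg_le 1 F -> deg_le k (fun x => poch (F x) k).
Proof.
move=> F1; have -> : k = (\sum_(0 <= i < k) 1)%N.
  by rewrite sum_nat_const_nat subn0 muln1.
apply: eq_deg_le (deg_le_prod _ (fun i => deg_leD F1 (deg_le_const 1 i%:R))) => x.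
by rewrite sum_nat_const_nat subn0 muln1.
Qed.

(** M_j is affine in x, so the k-th term of the j-th factor has degree at most k + (nu_j - k). *)
Lemma deg_le_krawtchouk rho nu : deg_le (mdeg nu) (krawtchouk rho N nu).
Proof.
have degN F : deg_le 1 F -> deg_le 1 (fun x => - F x).
  by move=> F1; apply: eq_deg_le (deg_leZ (-1) F1) => x; rewrite mulN1r.
have degM j : deg_le 1 (fun x => - krawtchouk_M nu x j : R).
  apply/degN/deg_leD; last exact: deg_le_const.
  apply: deg_leD; first exact: deg_le_const.
  by apply/degN/deg_le_sum => i _; exact: deg_le_coord.
rewrite mdegE.
apply: eq_deg_le => [x|]; first by rewrite ffunE.
apply: deg_leZ; apply: deg_le_prod => j; apply/deg_leZ/deg_le_sum => -[k /=].
rewrite ltnS => le_k _; rewrite -[X in deg_le X](subnKC le_k).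
apply: deg_leM; last first.
  by apply/deg_le_poch/deg_leD; [exact: degM|exact: deg_le_const].
by apply/deg_leZr/deg_leZr/deg_leZ/deg_le_poch/degN/deg_le_coord.
Qed.

End PolynomialFunctions.

(** * Orthogonality relations and inner products with monomials *)

Section Expansion.
Variables (R : realFieldType) (d : nat) (rho : 'I_d -> R).
Hypothesis rho01 : forall j : 'I_d, 0 < rho j < 1.
Hypothesis sum_rho_lt1 : \sum_j rho j < 1.

Lemma krawtchoukE N nu (x : simplex d N) :
  krawtchouk rho N nu x =
  (mfactorial nu)%:R / (N ^_ mdeg nu)%:R * (krawtchouk_gen rho x)@_nu.
Proof.
rewrite krawtchouk_mcoeff // poch_opp_nat invfM mulVKf ?signr_eq0 //.
by rewrite mulrA [_^-1 * _]mulrC.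
Qed.

Lemma ffact_neq0 N n : (n <= N)%N -> (N ^_ n)%:R != 0 :> R.
Proof. by move=> le_nN; rewrite pnatr_eq0 -lt0n ffact_gt0. Qed.

Lemma innerE N (f g : {ffun simplex d N -> R}) :
  inner rho f g =
  \sum_(x : simplex d N) N`!%:R / (mfactorial x)%:R * weight (rho_bold rho) x * (f x * g x).
Proof. by rewrite /inner mulr_sumr; apply: eq_bigr => x _; ring. Qed.

Lemma inner_weight_gt0 N (x : simplex d N) :
  0 < N`!%:R / (mfactorial x)%:R * weight (rho_bold rho) x.
Proof.
rewrite mulr_gt0 ?divr_gt0 ?ltr0n ?fact_gt0 ?mfactorial_gt0 //.
by apply: prodr_gt0 => i _; rewrite exprn_gt0 // rho_bold_gt0.
Qed.

Lemma innerC N (f g : {ffun simplex d N -> R}) : inner rho f g = inner rho g f.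
Proof. by rewrite /inner; congr (_ * _); apply: eq_bigr => x _; rewrite [f x * _]mulrC. Qed.

Lemma innerBl N (f g h : {ffun simplex d N -> R}) :
  inner rho (f - g) h = inner rho f h - inner rho g h.
Proof. by rewrite !innerE -sumrB; apply: eq_bigr => x _; rewrite !ffunE; ring. Qed.

Lemma inner_suml N (I : Type) (s : seq I) (P : pred I) (a : I -> R)
    (f : I -> {ffun simplex d N -> R}) g :
  inner rho [ffun x => \sum_(i <- s | P i) a i * f i x] g =
  \sum_(i <- s | P i) a i * inner rho (f i) g.
Proof.
rewrite innerE; under eq_bigr do rewrite ffunE mulr_suml mulr_sumr.
rewrite exchange_big; apply: eq_bigr => i _ /=.
by rewrite innerE mulr_sumr; apply: eq_bigr => x _; ring.
Qed.

Lemma inner_eq0 N (f : {ffun simplex d N -> R}) : inner rho f f = 0 -> f = 0.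
Proof.
rewrite innerE => /psumr_eq0P f0; apply/ffunP => x; rewrite ffunE.
have /eqP := f0 (fun y _ => mulr_ge0 (ltW (inner_weight_gt0 y)) (sqr_ge0 (f y))) x isT.
by rewrite mulf_eq0 gt_eqF ?inner_weight_gt0 //= mulf_eq0 orbb => /eqP.
Qed.

Lemma inner_krawtchouk N nu mu : (mdeg nu <= N)%N ->
  inner rho (krawtchouk rho N nu) (krawtchouk rho N mu) =
  (mfactorial nu)%:R / (N ^_ mdeg nu)%:R * weight (ortho_norm rho) nu * (nu == mu)%:R.
Proof.
move=> le_nu; have F_neq0 := ffact_neq0 le_nu.
have nu_neq0 := mfactorial_neq0 R nu.
transitivity ((mfactorial nu)%:R / (N ^_ mdeg nu)%:R
    * ((mfactorial mu)%:R / (N ^_ mdeg mu)%:R)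
    * ((N ^_ mdeg nu)%:R / (mfactorial nu)%:R * weight (ortho_norm rho) nu * (nu == mu)%:R)).
  rewrite -krawtchouk_gen_orthogonal // innerE mulr_sumr; apply: eq_bigr => x _.
  by rewrite !krawtchoukE; ring.
by case: eqP => [<-|_]; rewrite ?mulr0 // !mulr1; field; rewrite F_neq0 nu_neq0.
Qed.

Lemma krawtchouk_norm_neq0 N nu : (mdeg nu <= N)%N -> krawtchouk_norm rho N nu != 0.
Proof.
move=> le_nu; rewrite /krawtchouk_norm inner_krawtchouk // eqxx mulr1.
rewrite !mulf_neq0 ?invr_eq0 ?mfactorial_neq0 ?ffact_neq0 //.
by rewrite gt_eqF // prodr_gt0 // => j _; rewrite exprn_gt0 // ortho_norm_gt0.
Qed.

(** The parameter N enters the norm only through N^_|nu|; this is how C_nu(rho, n) replaces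
    C_nu(rho, N). *)
Lemma krawtchouk_norm_scale N nu : (mdeg nu <= N)%N ->
  krawtchouk_norm rho N nu =
  (mdeg nu)`!%:R / (N ^_ mdeg nu)%:R * krawtchouk_norm rho (mdeg nu) nu.
Proof.
move=> le_nu; have F_neq0 := ffact_neq0 le_nu; have f_neq0 := factorial_neq0 R (mdeg nu).
by rewrite /krawtchouk_norm !inner_krawtchouk // eqxx ffactnn; field; rewrite f_neq0 F_neq0.
Qed.

Lemma inner_mono_krawtchouk N n (alpha : simplex d n) nu : (n <= N)%N ->
  inner rho (mono N alpha) (krawtchouk rho N nu) =
  (mfactorial nu)%:R / (N ^_ mdeg nu)%:R
    * ((N ^_ n)%:R * weight (rho_bold rho) alpha * (krawtchouk_gen rho alpha)@_nu).
Proof.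
move=> le_nN; rewrite -mono_krawtchouk_gen // innerE mulr_sumr; apply: eq_bigr => x _.
by rewrite krawtchoukE; ring.
Qed.

(** The factors N^_n cancel, and the coefficient at alpha becomes a value of K_nu on the simplex of
    weight n, of which alpha is a point. *)
Lemma inner_mono_krawtchouk_lead N n (alpha : simplex d n) nu : (n <= N)%N -> mdeg nu = n ->
  inner rho (mono N alpha) (krawtchouk rho N nu) =
  n`!%:R * weight (rho_bold rho) alpha * krawtchouk rho n nu alpha.
Proof.
move=> le_nN deg_nu; have F_neq0 := ffact_neq0 le_nN; have f_neq0 := factorial_neq0 R n.
rewrite inner_mono_krawtchouk // krawtchoukE deg_nu ffactnn.
by field; rewrite f_neq0 F_neq0.
Qed.

(** As a point of the simplex of weight |beta|, beta has a generating function without terms of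
    degree |nu| > |beta|. *)
Lemma inner_mono_krawtchouk_eq0 N (beta : 'X_{1..d.+1}) nu :
  (mdeg beta < mdeg nu <= N)%N -> inner rho (mono N beta) (krawtchouk rho N nu) = 0.
Proof.
case/andP=> lt_nu le_nu; have [alpha aE] := simplexP (erefl (mdeg beta)).
rewrite -aE inner_mono_krawtchouk; last exact: ltnW (leq_trans lt_nu le_nu).
by rewrite mcoeff_krawtchouk_gen_eq0 ?mulr0.
Qed.

(** Induction on |gamma|: the relation x_i m_beta = m_(beta + U_i) + beta_i m_beta absorbs one power
    of x_i without raising the total degree. *)
Lemma inner_monomial_mono_eq0 N (gamma : 'X_{1..d}) (beta : 'X_{1..d.+1}) nu :
  (mdeg gamma + mdeg beta < mdeg nu <= N)%N ->
  inner rho [ffun x : simplex d N =>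
    (\prod_j (x (lift ord_max j))%:R ^+ gamma j) * (mono N beta : {ffun _ -> R}) x]
    (krawtchouk rho N nu) = 0.
Proof.
move gE : (mdeg gamma) => g; elim: g gamma gE beta => [|g IHg] gamma gE beta lt_nu.
  have /eqP := gE; rewrite mdeg_eq0 => /eqP g0.
  rewrite -[RHS](inner_mono_krawtchouk_eq0 lt_nu); congr (inner _ _ _).
  apply/ffunP => x; rewrite ffunE big1 ?mul1r // => j _.
  by rewrite g0 mnm0E.
have [j gj] : exists j, gamma j != 0%N.
  apply/existsP; rewrite -negb_forall; apply: contra_eqN gE => /forallP g0.
  by rewrite mdegE big1 // => j _; apply/eqP.
have gammaE : gamma = (U_(j) + (gamma - U_(j)))%MM by rewrite addmC submK // lep1mP.
move: (gamma - U_(j))%MM gammaE gE => gamma' -> {gamma gj}.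
rewrite mdegD mdeg1 add1n => -[gE].
pose i := lift ord_max j; pose b b' := [ffun x : simplex d N =>
    (\prod_j (x (lift ord_max j))%:R ^+ gamma' j) * (mono N b' : {ffun _ -> R}) x].
have lt1 : (g + mdeg (beta + U_(i)) < mdeg nu <= N)%N by rewrite mdegD mdeg1 addn1 addnS -addSn.
have lt2 : (g + mdeg beta < mdeg nu <= N)%N.
  by case/andP: lt_nu => lt_nu ->; rewrite andbT (ltn_trans _ lt_nu).
have E1 := IHg _ gE _ lt1; have E2 := IHg _ gE _ lt2.
transitivity (inner rho (b (beta + U_(i))%MM) (krawtchouk rho N nu)
    + (beta i)%:R * inner rho (b beta) (krawtchouk rho N nu)); last first.
  by rewrite E1 E2 mulr0 addr0.
rewrite !innerE mulr_sumr -big_split.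
refine (eq_bigr _ (fun (x : simplex d N) Px => _)); rewrite /= !ffunE {Px}.
have -> : \prod_k (x (lift ord_max k))%:R ^+ (U_(j) + gamma')%MM k =
    (x i)%:R * \prod_k (x (lift ord_max k))%:R ^+ gamma' k :> R.
  rewrite (bigD1 j) //= [in RHS](bigD1 j) //= mnmDE mnm1E eqxx exprD expr1 mulrA.
  congr (_ * _); apply: eq_bigr => k neq_kj.
  by rewrite mnmDE mnm1E eq_sym (negPf neq_kj).
rewrite mdegD mdeg1 addn1 exprS.
have -> : \prod_k poch (- (x k)%:R) ((beta + U_(i))%MM k) =
    (- (x i)%:R + (beta i)%:R) * \prod_k poch (- (x k)%:R) (beta k) :> R.
  rewrite (bigD1 i) //= [in RHS](bigD1 i) //= mnmDE mnm1E eqxx addn1.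
  rewrite {1}/poch big_nat_recr //= -/(poch _ _) mulrA [X in X * _]mulrC.
  congr (_ * _); apply: eq_bigr => k neq_ki.
  by rewrite mnmDE mnm1E eq_sym (negPf neq_ki) addn0.
ring.
Qed.

(** Expand the polynomial in monomials and use the previous vanishing with beta = 0, where m_0 =
    1. *)
Lemma krawtchouk_orthogonal N nu (f : {ffun simplex d N -> R}) :
  (mdeg nu <= N)%N -> is_poly_lt (mdeg nu) f -> inner rho (krawtchouk rho N nu) f = 0.
Proof.
move=> le_nu [p sp fE].
have -> : f = [ffun x => \sum_(m <- msupp p) p@_m * [ffun x : simplex d N =>
    (\prod_j (x (lift ord_max j))%:R ^+ m j) * (mono N 0%MM : {ffun _ -> R}) x] x].
  apply/ffunP => x; rewrite fE mevalE ffunE; apply: eq_bigr => m _; rewrite !ffunE.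
  rewrite mdeg0 expr0 mul1r [X in _ = _ * (_ * X)]big1 ?mulr1 // => i _.
  by rewrite mnm0E /poch big_geq.
rewrite innerC inner_suml big_seq big1 // => m m_p.
rewrite inner_monomial_mono_eq0 ?mulr0 // mdeg0 addn0 le_nu andbT.
exact: leq_trans (msize_mdeg_lt m_p) sp.
Qed.

(** * Completeness, and the monic polynomials as projections *)

Lemma krawtchouk_expansion N (f : {ffun simplex d N -> R}) x :
  f x = \sum_(m : simplex d N) inner rho f (krawtchouk rho N (mtrunc m))
    / krawtchouk_norm rho N (mtrunc m) * krawtchouk rho N (mtrunc m) x.
Proof.
(* Rows and columns are both indexed by the simplex. Orthogonality says that F G is the identity;
   the completeness relation is that G F is too. *)
pose F (m y : simplex d N) := krawtchouk rho N (mtrunc m) y / krawtchouk_norm rho N (mtrunc m)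
  * (N`!%:R / (mfactorial y)%:R * weight (rho_bold rho) y).
pose G (y m : simplex d N) := krawtchouk rho N (mtrunc m) y.
have FG m m' : \sum_y F m y * G y m' = (m == m')%:R.
  have le_m := mdeg_mtrunc_le m.
  transitivity (inner rho (krawtchouk rho N (mtrunc m)) (krawtchouk rho N (mtrunc m'))
      / krawtchouk_norm rho N (mtrunc m)).
    by rewrite innerE mulr_suml; apply: eq_bigr => y _; rewrite /F /G; ring.
  case: eqP => [<-|neq_m]; first by rewrite divff // krawtchouk_norm_neq0.
  rewrite inner_krawtchouk //; case: eqP => [/mtrunc_inj//|_].
  by rewrite mulr0 mul0r.
transitivity (\sum_y f y * (y == x)%:R).
  by rewrite (bigD1 x) //= eqxx mulr1 big1 ?addr0 // => y /negPf->; rewrite mulr0.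
under eq_bigr do rewrite eq_sym -(inverse_sumC FG) mulr_sumr.
rewrite exchange_big; apply: eq_bigr => m _ /=.
rewrite innerE !mulr_suml; apply: eq_bigr => y _; rewrite /F /G; ring.
Qed.

(** Passes from the indexing of the basis by points of the simplex to a sum over nu with |nu| =
    n. *)
Lemma big_mtrunc N n (G : 'X_{1..d} -> R) : (n <= N)%N ->
  \sum_(m : simplex d N | mdeg (mtrunc m) == n) G (mtrunc m) =
  \sum_(nu : 'X_{1..d < n.+1} | mdeg nu == n) G nu.
Proof.
move=> le_nN.
transitivity (\sum_(m : simplex d N | mdeg (mtrunc m) == n)
    \sum_(nu : 'X_{1..d < n.+1} | (mdeg nu == n) && (bmnm nu == mtrunc m)) G nu).
  apply: eq_bigr => m /eqP deg_m.
  have lt_m : (mdeg (mtrunc (m : simplex d N)) < n.+1)%N by rewrite deg_m.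
  rewrite (big_pred1 (BMultinom lt_m)) // => nu /=; rewrite bmeqP /=.
  by apply: andb_idl => /eqP->; rewrite deg_m.
rewrite (exchange_big_dep (fun nu : 'X_{1..d < n.+1} => mdeg nu == n)) /=; last first.
  by move=> m nu _ /andP[].
apply: eq_bigr => nu /eqP deg_nu.
have [m mE] := mtruncP (eq_leq deg_nu : mdeg nu <= n)%N.
have le_nu : (mdeg nu <= N)%N by rewrite deg_nu.
have {m mE} [m mE] := mtruncP le_nu.
rewrite (big_pred1 m) // => m' /=; rewrite deg_nu eqxx /= -mE.
apply/andP/eqP => [[_ /eqP/mtrunc_inj]//|->].
by rewrite mE deg_nu !eqxx.
Qed.

(** The component of f in the degree-n part of the orthogonal basis. *)
Definition krawtchouk_proj N n (f : {ffun simplex d N -> R}) : {ffun simplex d N -> R} :=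
  [ffun x => \sum_(m : simplex d N | mdeg (mtrunc m) == n)
     inner rho f (krawtchouk rho N (mtrunc m)) / krawtchouk_norm rho N (mtrunc m)
       * krawtchouk rho N (mtrunc m) x].

Lemma is_poly_ltB N b (f g : {ffun simplex d N -> R}) :
  is_poly_lt b f -> is_poly_lt b g -> is_poly_lt b (f - g).
Proof.
move=> [p sp fE] [q sq gE]; exists (p - q) => [|x]; last by rewrite !ffunE fE gE mevalB.
by rewrite (leq_trans (msizeD_le _ _)) // geq_max sp msizeN.
Qed.

Lemma is_monic_krawtchouk_proj N n (alpha : simplex d n) : (n <= N)%N ->
  is_monic_krawtchouk rho alpha (krawtchouk_proj n (mono N alpha)).
Proof.
move=> le_nN; rewrite /is_monic_krawtchouk /is_orthopoly !mdeg_simplex; split; first split.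
- apply: (@eq_deg_le R d N n _ _ (fun x => esym (ffunE _ x))).
  apply: deg_le_sum => m /eqP/eq_leq le_m.
  exact/deg_leZ/(deg_leW le_m)/deg_le_krawtchouk.
- move=> g g_lt; rewrite inner_suml big1 // => m /eqP deg_m.
  by rewrite krawtchouk_orthogonal ?mulr0 ?deg_m // mdeg_mtrunc_le.
pose c (m : simplex d N) := - (inner rho (mono N alpha) (krawtchouk rho N (mtrunc m))
   / krawtchouk_norm rho N (mtrunc m)).
have E x : (krawtchouk_proj n (mono N alpha) - mono N alpha) x =
    \sum_(m : simplex d N | (mdeg (mtrunc m) < n)%N) c m * krawtchouk rho N (mtrunc m) x.
  rewrite !ffunE; set S := \sum_(m | _) _.
  rewrite -[X in S - X](_ : (mono N alpha : {ffun simplex d N -> R}) x = _); last by rewrite ffunE.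
  rewrite (krawtchouk_expansion (mono N alpha)).
  rewrite (bigID (fun m : simplex d N => mdeg (mtrunc m) == n)) /= -/S opprD addNKr.
  (* The components of m_alpha of degree above n are 0, so the difference involves only degrees
     below n. *)
  rewrite (bigID (fun m : simplex d N => (mdeg (mtrunc m) < n)%N)) /= [X in - (_ + X)]big1 => [|m].
    rewrite addr0 -sumrN; apply: eq_big => [m|m _]; last by rewrite mulNr.
    by case: ltngtP.
  case: ltngtP => // lt_n _; rewrite inner_mono_krawtchouk_eq0 ?mul0r //.
  by rewrite mdeg_simplex lt_n mdeg_mtrunc_le.
(* For n = 0 the sum is empty and the difference is 0, matching Pi_{-1} = {0}; [deg_le] only covers
   bounds of the form k + 1. *)
case: n alpha le_nN c E => [|n] alpha le_nN c E.
  by exists 0 => [|x]; rewrite ?msize0 // E big1 ?meval0.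
apply: (@eq_deg_le R d N n _ _ (fun x => esym (E x))).
apply: deg_le_sum => m; rewrite ltnS => le_m.
exact/deg_leZ/(deg_leW le_m)/deg_le_krawtchouk.
Qed.

(** The difference of two candidates has degree below n, and both are orthogonal to such functions;
    it is therefore orthogonal to itself and vanishes. *)
Lemma monic_krawtchoukE N n (alpha : simplex d n) : (n <= N)%N ->
  monic_krawtchouk rho N alpha = krawtchouk_proj n (mono N alpha).
Proof.
move=> le_nN; have [[_ orthL] ltL] := is_monic_krawtchouk_proj alpha le_nN.
apply: classical_sets.xget_unique; first exact: is_monic_krawtchouk_proj.
move=> f [[_ orthf] ltf]; apply/eqP; rewrite -subr_eq0; apply/eqP/inner_eq0.
set L := krawtchouk_proj n _ in orthL ltL *.
have ltfL : is_poly_lt (mdeg alpha) (f - L).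
  by have := is_poly_ltB ltf ltL; rewrite opprB addrA subrK.
by rewrite innerBl orthf // orthL // subrr.
Qed.

Lemma monic_krawtchouk_expansion N n (alpha : simplex d n) (x : simplex d N) : (n <= N)%N ->
  monic_krawtchouk rho N alpha x =
  (-1) ^+ n * poch (- N%:R) n * weight (rho_bold rho) alpha *
    \sum_(nu : 'X_{1..d < n.+1} | mdeg nu == n)
      krawtchouk rho n nu alpha / krawtchouk_norm rho n nu * krawtchouk rho N nu x.
Proof.
move=> le_nN; rewrite monic_krawtchoukE // ffunE.
rewrite -(big_mtrunc (fun nu => krawtchouk rho n nu alpha / krawtchouk_norm rho n nu
  * krawtchouk rho N nu x) le_nN) mulr_sumr; apply: eq_bigr => m /eqP deg_m.
rewrite inner_mono_krawtchouk_lead // krawtchouk_norm_scale ?mdeg_mtrunc_le // deg_m.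
rewrite poch_opp_nat mulrA -exprMn mulrNN mulr1 expr1n mul1r.
have C_neq0 : krawtchouk_norm rho n (mtrunc (m : simplex d N)) != 0.
  by rewrite krawtchouk_norm_neq0 ?deg_m.
by field; rewrite C_neq0 ffact_neq0 ?factorial_neq0.
Qed.

End Expansion.

(** * The mutual expansions of the two families *)

Theorem proposition4p3 (R : realFieldType) (d n N : nat) (rho : 'I_d -> R)
    (d_gt0 : (0 < d)%N) (le_nN : (n <= N)%N)
    (rho01 : forall j : 'I_d, 0 < rho j < 1)
    (sum_rho_lt1 : \sum_j rho j < 1) :
  (forall (x : simplex d N) (nu : 'X_{1..d}), mdeg nu = n ->
    krawtchouk rho N nu x =
      (-1) ^+ n * n`!%:R / poch (- N%:R) n *
      \sum_(alpha : simplex d n)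
        krawtchouk rho n nu alpha / (mfactorial alpha)%:R *
        monic_krawtchouk rho N alpha x)
  /\
  (forall (x : simplex d N) (alpha : simplex d n),
    monic_krawtchouk rho N alpha x =
      (-1) ^+ n * poch (- N%:R) n * weight (rho_bold rho) alpha *
      \sum_(nu : 'X_{1..d < n.+1} | mdeg nu == n)
        krawtchouk rho n nu alpha / krawtchouk_norm rho n nu *
        krawtchouk rho N nu x).
Proof.
split=> [x nu deg_nu|x alpha]; last exact: monic_krawtchouk_expansion.
(* The second formula is inserted into the right-hand side of the first, and the sums over alpha and
   nu are exchanged. *)
under eq_bigr do rewrite monic_krawtchouk_expansion // mulr_sumr mulr_sumr.
rewrite exchange_big /= mulr_sumr.
have lt_nu : (mdeg nu < n.+1)%N by rewrite deg_nu.
pose nu' := BMultinom lt_nu.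
(* The two prefactors multiply to n!, the normalisation of the inner product on the simplex of
   weight n. *)
have scale : (-1) ^+ n * n`!%:R / poch (- N%:R) n * ((-1) ^+ n * poch (- N%:R) n) = n`!%:R :> R.
  have sgn2 : (-1) ^+ n * (-1) ^+ n = 1 :> R by rewrite -exprMn mulrNN mulr1 expr1n.
  have poch_neq0 : poch (- N%:R) n != 0 :> R.
    by rewrite poch_opp_nat mulf_neq0 ?signr_eq0 ?ffact_neq0.
  move: (poch _ _) ((-1) ^+ n) poch_neq0 sgn2 => p e p_neq0 sgn2.
  by rewrite -[RHS]mul1r -[X in _ = X * _]sgn2; field.
(* The sum over alpha, with weight n! rho^alpha / alpha!, is the inner product of K_nu and K_mu at
   level n, so only mu = nu remains. *)
transitivity (\sum_(mu : 'X_{1..d < n.+1} | mdeg mu == n)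
    inner rho (krawtchouk rho n nu) (krawtchouk rho n mu) / krawtchouk_norm rho n mu
      * krawtchouk rho N mu x).
  rewrite (bigD1 nu') /= ?deg_nu //= divff ?mul1r; last first.
    by rewrite krawtchouk_norm_neq0 ?deg_nu.
  rewrite big1 ?addr0 // => mu /andP[_]; rewrite bmeqP /= eq_sym => /negPf neq_mu.
  by rewrite inner_krawtchouk ?deg_nu // neq_mu mulr0 !mul0r.
apply: eq_bigr => mu _; rewrite innerE !mulr_suml mulr_sumr.
apply: eq_bigr => alpha _; move: scale.
move: (_ / poch _ _) (_ * poch _ _) => c s <-.
ring.
Qed.
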